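(* Let $S,W,K$ be integers with $0\le K<W\le S$, and let $P_{Y|X}$ be a discrete memoryless channel with finite input alphabet $\mathcal X$ and finite output alphabet $\mathcal Y$. Suppose that an $(n_{\mathrm{ID}},N_{\mathrm{ID}},\lambda_1,\lambda_2)$ identification code for $P_{Y|X}$ is constructed from an $(S,N,W,K)$ binary constant-weight code by concatenation with a transmission code. Then both upper bounds below hold for the number $N_{\mathrm{ID}}$ of identifiers. (i) $$N_{\mathrm{ID}}\le\left\lfloor\frac{S}{W}\left\lfloor\frac{S-1}{W-1}\left\lfloor\cdots\left\lfloor\frac{S-K}{W-K}\right\rfloor\cdots\right\rfloor\right\rfloor\right\rfloor ,$$ where the nested floors run over the fractions $\frac{S-r}{W-r}$, $r=0,\dots,K$, with $r=0$ outermost. (ii) For every integer $\ell\ge1$ and every $d'\in\{1,\dots,K\}$, with $S'=S-d'$, $W'=W-d'$, $K'=K-d'$, $C_{\ell,u}=\sum_{k=0}^{u}(-1)^k\binom{u}{k}(u-k)^{\ell}$ and $A=\sum_{u=1}^{\ell}\binom{W'}{u}^2C_{\ell,u}\big/\binom{S'}{u}$ (summands with $u>W'$ taken to be $0$), if $A-(K')^\ell>0$ then $$N_{\mathrm{ID}}\le\left\lfloor\frac{S}{W}\left\lfloor\frac{S-1}{W-1}\left\lfloor\cdots\left\lfloor\frac{S'+1}{W'+1}\left\lfloor\frac{(W')^{\ell}-(K')^{\ell}}{A-(K')^{\ell}}\right\rfloor\right\rfloor\cdots\right\rfloor\right\rfloor\right\rfloor ,$$ where the outer nested floors run over the fractions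 $\frac{S-r}{W-r}$, $r=0,\dots,d'-1$, with $r=0$ outermost.
   Context: An $(S,N,W,K)$ binary constant-weight code (CWC) is a set of $N$ distinct codewords $x_1,\dots,x_N\in\{0,1\}^S$, $x_j=(x_{j,0},\dots,x_{j,S-1})$, each of Hamming weight exactly $W$, such that for all $j\ne j'$, $\sum_{s=0}^{S-1}x_{j,s}x_{j',s}\le K$. An $(n_{\mathrm{ID}},N_{\mathrm{ID}},\lambda_1,\lambda_2)$ identification (ID) code for a discrete memoryless channel $P_{Y|X}$ consists of probability distributions $Q_i$ on $\mathcal X^{n_{\mathrm{ID}}}$ and (possibly overlapping) demapping regions $\mathcal D_i\subset\mathcal Y^{n_{\mathrm{ID}}}$, $i=1,\dots,N_{\mathrm{ID}}$, such that for all $i\neq i'$ $$1-\sum_{y\in\mathcal D_i}\sum_{x\in\mathcal X^{n_{\mathrm{ID}}}}Q_i(x)P^{n_{\mathrm{ID}}}_{Y|X}(y|x)\le\lambda_1,\qquad \sum_{y\in\mathcal D_i}\sum_{x\in\mathcal X^{n_{\mathrm{ID}}}}Q_{i'}(x)P^{n_{\mathrm{ID}}}_{Y|X}(y|x)\le\lambda_2 ,$$ where $P^{n}_{Y|X}(y|x)=\prod_{t=1}^nP_{Y|X}(y_t|x_t)$. Constructing an ID code from a CWC by concatenation with a transmission code means: a transmission code for $P_{Y|X}$ with blocklength $n_{\mathrm{ID}}$ and $S$ distinct codewords $c_0,\dots,c_{S-1}\in\mathcal X^{n_{\mathrm{ID}}}$ is given; the identifiers $i\in\{1,\dots,N_{\mathrm{ID}}\}$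 are in one-to-one correspondence with the codewords $x_i$ of the CWC (one identifier for each CWC codeword); and $Q_i$ is the uniform distribution on the $W$ transmission codewords $\{c_s: x_{i,s}=1\}$. *)

(* Defs.v *)
From HB Require Import structures.
From mathcomp Require Import all_boot all_order all_algebra.
From mathcomp Require Import reals.

Set Implicit Arguments.
Unset Strict Implicit.
Unset Printing Implicit Defensive.

Import Order.TTheory GRing.Theory Num.Theory.
Local Open Scope ring_scope.

Record distr (R : realType) (T : finType) := Distr {
  pmf :> T -> R ;
  pmf_ge0 : forall t, 0 <= pmf t ;
  pmf_sum1 : \sum_t pmf t = 1 }.

Definition uniform (R : realType) (T : finType) (A : {set T}) (t : T) : R :=
  if t \in A then #|A|%:R^-1 else 0.

(* [P x y] is the transition probability P_{Y|X}(y|x). *)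
Definition dmc (R : realType) (X Y : finType) := X -> distr R Y.

Definition block (n : nat) (X : finType) := {ffun 'I_n -> X}.

Definition dmc_ext (R : realType) (X Y : finType) (P : dmc R X Y) (n : nat)
    (x : block n X) (y : block n Y) : R :=
  \prod_(t < n) P (x t) (y t).

(* Probability that the channel output lies in [D] for an input drawn from
   [Q]. *)
Definition output_prob (R : realType) (X Y : finType) (P : dmc R X Y)
    (n : nat) (Q : distr R (block n X)) (D : {set block n Y}) : R :=
  \sum_(y in D) \sum_(x : block n X) Q x * dmc_ext P x y.

(* Identifiers are numbered from 0. Both error bounds are quantified over pairs
   of distinct identifiers, so that they are void when [N = 1]. *)
Record id_code (R : realType) (X Y : finType) (P : dmc R X Y)
    (n N : nat) (lambda1 lambda2 : R) := IdCode {
  id_distr : 'I_N -> distr R (block n X) ;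
  id_region : 'I_N -> {set block n Y} ;
  id_errors : forall i i' : 'I_N, i != i' ->
    1 - output_prob P (id_distr i) (id_region i) <= lambda1
    /\ output_prob P (id_distr i') (id_region i) <= lambda2 }.

Definition binword (S : nat) := {ffun 'I_S -> bool}.

Definition overlap (S : nat) (x x' : binword S) : nat :=
  (\sum_(s < S) x s * x' s)%N.

Definition hweight (S : nat) (x : binword S) : nat := #|[set s | x s]|.

Definition is_cwc (S N W K : nat) (C : {set binword S}) : Prop :=
  [/\ #|C| = N,
      forall x, x \in C -> hweight x = W
    & forall x x', x \in C -> x' \in C -> x != x' -> (overlap x x' <= K)%N].

(* Only the codebook of a transmission code enters the concatenation. *)
Record transmission_code (X : finType) (n S : nat) := TransmissionCode {
  codeword :> 'I_S -> block n X ;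
  codeword_inj : injective codeword }.

Definition constructed_by_concatenation (R : realType) (X Y : finType)
    (P : dmc R X Y) (n NID S : nat) (lambda1 lambda2 : R)
    (I : id_code P n NID lambda1 lambda2)
    (C : {set binword S}) (c : transmission_code X n S) : Prop :=
  exists x : 'I_NID -> binword S,
    [/\ injective x,
        [set x i | i : 'I_NID] = C
      & forall i, id_distr I i =1 uniform R [set c s | s : 'I_S & x i s]].

(* [S - r] and [W - r] are truncated, hence meant for [d <= W <= S]:
   |_ S/W |_ (S-1)/(W-1) |_ ... |_ (S-d+1)/(W-d+1) * m _| ... _| _| _| *)
Definition nested_floor (S W d : nat) (m : int) : int :=
  foldr (fun r v : _ =>
    Num.floor ((S - r)%N%:R / (W - r)%N%:R * v%:~R : rat)) m (iota 0 d).

(* Number of surjections from an l-element set onto a u-element set. *)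
Definition moment_coef (l u : nat) : rat :=
  \sum_(0 <= k < u.+1) (-1) ^+ k * 'C(u, k)%:R * (u - k)%N%:R ^+ l.

Definition moment_sum (S W l : nat) : rat :=
  \sum_(1 <= u < l.+1 | (u <= W)%N)
    'C(W, u)%:R ^+ 2 * moment_coef l u / 'C(S, u)%:R.

(* Main.v *)
Require Import Defs.
From mathcomp Require Import all_boot all_order all_algebra.
From mathcomp Require Import reals.
From mathcomp Require Import ring lra.

Import Order.TTheory GRing.Theory Num.Theory.
Local Open Scope ring_scope.

(** View the codewords as [W]-subsets [f i] of the coordinates.  For a set [D]
    of [r] coordinates let [M_r] bound the number of [f i] containing [D].
    Counting the pairs [(s, i)] with [s] in [f i] but not in [D] gives
    [(W - r) M_r <= (S - r) M_(r + 1)], which produces the nested floors.  In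
    (i) the recursion stops at [M_(K + 1) = 1].  In (ii) it stops at [r = d'],
    where the [l]-th moment of the pairwise overlaps is bounded from above by
    the intersection property, and from below by expanding [v ^ l] into
    binomial coefficients [C(v, u)] and applying Cauchy-Schwarz to the numbers
    of blocks that contain each [u]-set. *)

Lemma moment_coef0 (u : nat) : moment_coef 0 u = (u == 0%N)%:R.
Proof.
(* The right side becomes [(1 - 1) ^+ u], expanded by the binomial theorem. *)
rewrite /moment_coef -[RHS](expr0n rat) -[X in X ^+ u](subrr 1) exprBn big_mkord.
by apply: eq_bigr => k _; rewrite !expr1n expr0 !mulr1 mulr_natr.
Qed.

Lemma moment_coefS0 (l : nat) : moment_coef l.+1 0 = 0.
Proof. by rewrite /moment_coef big_nat1 exprS mul0r mulr0. Qed.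

(** The recurrence for surjections, derived from the alternating sum: one factor [u.+1 - k] is
    absorbed into the binomial coefficient, then Pascal's rule splits what is left. *)
Lemma moment_coefSS (l u : nat) :
  moment_coef l.+1 u.+1 = u.+1%:R * (moment_coef l u.+1 + moment_coef l u).
Proof.
rewrite /moment_coef.
have -> : \sum_(0 <= k < u.+2) (-1) ^+ k * 'C(u.+1, k)%:R * (u.+1 - k)%N%:R ^+ l.+1
   = u.+1%:R * \sum_(0 <= k < u.+2) (-1) ^+ k * 'C(u, k)%:R * (u.+1 - k)%N%:R ^+ l :> rat.
  rewrite mulr_sumr; apply: eq_big_nat => k /andP[_ ku].
  rewrite exprS.
  have : (u.+1 * 'C(u, k) = (u.+1 - k) * 'C(u.+1, k))%N by exact: mul_bin_down.
  move=> /(congr1 (fun m => m%:R : rat)); rewrite !natrM => E.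
  transitivity ((-1) ^+ k * (u.+1 - k)%N%:R ^+ l
                  * ((u.+1 - k)%N%:R * 'C(u.+1, k)%:R) : rat); first by ring.
  by rewrite -E; ring.
congr (_ * _).
(* The terms at [k = 0] agree; the others match by Pascal's rule after an index shift. *)
rewrite !(big_nat_recl u.+1) //= !bin0 -addrA; congr (_ + _).
rewrite -big_split /=.
by apply: eq_bigr => k _; rewrite binS natrD subSS exprS; ring.
Qed.

Lemma moment_coef_ge0 (l u : nat) : 0 <= moment_coef l u.
Proof.
elim: l u => [|l IH] [|u]; rewrite ?moment_coef0 ?moment_coefS0 ?ler0n //.
by rewrite moment_coefSS mulr_ge0 ?ler0n ?addr_ge0.
Qed.

Lemma moment_coef_small (l u : nat) : (l < u)%N -> moment_coef l u = 0.
Proof.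
elim: l u => [|l IH] [|u] // lu; first by rewrite moment_coef0.
by rewrite moment_coefSS !IH ?addr0 ?mulr0 // ltnW.
Qed.

(** Combinatorially, maps from an [l]-set to a [v]-set are sorted by their image, of size [u]. The
    proof is by induction on [l]. *)
Lemma exprn_moment_coef (l v : nat) :
  v%:R ^+ l = \sum_(0 <= u < l.+1) moment_coef l u * 'C(v, u)%:R.
Proof.
elim: l => [|l IH]; first by rewrite big_nat1 moment_coef0 bin0 mulr1.
have mul_bin u : v%:R * 'C(v, u)%:R =
    u%:R * 'C(v, u)%:R + u.+1%:R * 'C(v, u.+1)%:R :> rat.
  rewrite -!natrM -natrD mul_bin_left -mulnDl; have [uv|vu] := leqP u v.
    by rewrite subnKC.
  by rewrite bin_small ?muln0.
pose F u := moment_coef l u * (u%:R * 'C(v, u)%:R).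
(* The shift loses nothing: [F 0 = 0], and [F l.+1 = 0] because [moment_coef l l.+1] vanishes. *)
have shiftF : \sum_(0 <= u < l.+1) F u = \sum_(0 <= u < l.+1) F u.+1.
  have : \sum_(0 <= u < l.+2) F u = \sum_(0 <= u < l.+1) F u.
    by rewrite big_nat_recr //= {2}/F moment_coef_small // mul0r addr0.
  by rewrite big_nat_recl //= {1}/F !mul0r mulr0 add0r => ->.
rewrite exprS IH mulr_sumr [RHS]big_nat_recl // moment_coefS0 mul0r add0r.
rewrite (eq_bigr (fun u => F u + moment_coef l u * (u.+1%:R * 'C(v, u.+1)%:R))).
  rewrite big_split shiftF -big_split /=; apply: eq_bigr => u _.
  by rewrite moment_coefSS /F; ring.
by move=> u _; rewrite mulrCA mul_bin mulrDr.
Qed.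

(** Cauchy-Schwarz, from the nonnegativity of the squared deviations from the mean [m]. For empty
    [A] the inverse of 0 is 0. *)
Lemma sum_sqr_ge (T : finType) (A : {set T}) (g : T -> rat) :
  (\sum_(t in A) g t) ^+ 2 / #|A|%:R <= \sum_(t in A) g t ^+ 2.
Proof.
have [->|An0] := eqVneq #|A| 0%N.
  by rewrite invr0 mulr0 sumr_ge0 // => t _; rewrite sqr_ge0.
set s := \sum_(t in A) g t; set m := s / #|A|%:R.
have A0 : #|A|%:R != 0 :> rat by rewrite pnatr_eq0.
have : 0 <= \sum_(t in A) (g t - m) ^+ 2.
  by rewrite sumr_ge0 // => t _; rewrite sqr_ge0.
under eq_bigr do rewrite sqrrB -mulrnAl -mulr_natl.
rewrite big_split big_split /= sumr_const sumrN -mulr_suml -mulr_sumr -/s.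
rewrite -mulr_natr => H.
rewrite -subr_ge0; apply: le_trans H _.
by rewrite le_eqVlt; apply/orP; left; apply/eqP; rewrite /m; field.
Qed.

(** Double counting turns the right side into a sum, over the [u]-subsets of [E], of the squared
    number of blocks containing each. The unsquared numbers add up to [#|P| * 'C(W, u)], so
    Cauchy-Schwarz applies. *)
Lemma sum_bin_cardsI (I T : finType) (P : {set I}) (f : I -> {set T})
    (E : {set T}) (W u : nat) :
  (forall i, i \in P -> f i \subset E) -> (forall i, i \in P -> #|f i| = W) ->
  #|P|%:R ^+ 2 * ('C(W, u)%:R ^+ 2 / 'C(#|E|, u)%:R) <=
  \sum_(i in P) \sum_(j in P) 'C(#|f i :&: f j|, u)%:R :> rat.
Proof.
move=> fE fW.
pose Dr := [set U : {set T} | (U \subset E) && (#|U| == u)].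
pose inc i (U : {set T}) : rat := (U \subset f i)%:R.
have card_inc (B : {set T}) : B \subset E ->
    \sum_(U in Dr) (U \subset B)%:R = 'C(#|B|, u)%:R :> rat.
  move=> BE; rewrite -cards_draws -sum1_card natr_sum big_mkcond /=.
  rewrite [RHS]big_mkcond; apply: eq_bigr => U _; rewrite !inE.
  case UB: (U \subset B); rewrite /= ?if_same //.
  by rewrite (subset_trans UB BE).
have -> : \sum_(i in P) \sum_(j in P) 'C(#|f i :&: f j|, u)%:R =
    \sum_(U in Dr) (\sum_(i in P) inc i U) ^+ 2.
  under [RHS]eq_bigr do rewrite expr2 mulr_suml.
  rewrite [RHS]exchange_big /=; apply: eq_bigr => i iP.
  under [RHS]eq_bigr do rewrite mulr_sumr.
  rewrite [RHS]exchange_big /=; apply: eq_bigr => j jP.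
  rewrite -card_inc; last by rewrite subIset // fE.
  by apply: eq_bigr => U _; rewrite subsetI -mulnb natrM.
have sum_inc : \sum_(U in Dr) \sum_(i in P) inc i U = #|P|%:R * 'C(W, u)%:R.
  rewrite exchange_big /= mulr_natl -sumr_const; apply: eq_bigr => i iP.
  by rewrite card_inc ?fE // fW.
by apply: le_trans (sum_sqr_ge _ Dr _); rewrite sum_inc cards_draws mulrA exprMn.
Qed.

(** Both estimates concern [mom], taken over ordered pairs with the diagonal included; dividing them
    by [#|P|] gives the claim. The product form is valid whatever the sign of the second factor. *)
Lemma moment_bound (I T : finType) (P : {set I}) (f : I -> {set T})
    (E : {set T}) (W K l : nat) :
  (forall i, i \in P -> f i \subset E) -> (forall i, i \in P -> #|f i| = W) ->
  (forall i j, i \in P -> j \in P -> i != j -> (#|f i :&: f j| <= K)%N) ->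
  (K <= W)%N ->
  #|P|%:R * (moment_sum #|E| W l - K%:R ^+ l) <= W%:R ^+ l - K%:R ^+ l.
Proof.
move=> fE fW fK KW.
have [->|Pn0] := eqVneq #|P| 0%N.
  by rewrite mul0r subr_ge0 lerXn2r ?nnegrE ?ler0n ?ler_nat.
have P0 : 0 < #|P|%:R :> rat by rewrite ltr0n lt0n.
pose mom : rat := \sum_(i in P) \sum_(j in P) #|f i :&: f j|%:R ^+ l.
have lo : #|P|%:R ^+ 2 * moment_sum #|E| W l <= mom.
  rewrite /mom; under [leRHS]eq_bigr do under eq_bigr do rewrite exprn_moment_coef.
  under [leRHS]eq_bigr do rewrite exchange_big /=.
  (* [moment_sum] starts at [u = 1], so the nonnegative term [u = 0] is discarded. *)
  rewrite exchange_big /= big_ltn //= -[leLHS]add0r lerD //.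
    by do 2 (apply: sumr_ge0 => ? _); rewrite mulr_ge0 ?moment_coef_ge0.
  rewrite /moment_sum big_mkcond mulr_sumr; apply: ler_sum => u _.
  under [leRHS]eq_bigr do rewrite -mulr_sumr.
  rewrite -mulr_sumr; case: ifP => _; last first.
    rewrite mulr0 mulr_ge0 ?moment_coef_ge0 //.
    by do 2 (apply: sumr_ge0 => ? _).
  rewrite [X in _ * X](_ : _ = moment_coef l u * ('C(W, u)%:R ^+ 2 / 'C(#|E|, u)%:R)).
    by rewrite mulrCA ler_wpM2l ?moment_coef_ge0 // sum_bin_cardsI.
  by rewrite mulrA (mulrC (moment_coef _ _)).
have hi : mom <= #|P|%:R * (W%:R ^+ l + (#|P|%:R - 1) * K%:R ^+ l).
  rewrite /mom mulr_natl -sumr_const; apply: ler_sum => i iP.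
  (* The diagonal pair contributes [W ^ l], every other pair at most [K ^ l]. *)
  rewrite (bigD1 i) //= setIid fW // lerD2l.
  apply: (@le_trans _ _ (\sum_(j in P | j != i) K%:R ^+ l)).
    apply: ler_sum => j /andP[jP ji].
    by rewrite lerXn2r ?nnegrE ?ler0n // ler_nat fK // eq_sym.
  have -> : #|P|%:R - 1 = #|P :\ i|%:R :> rat
    by rewrite (cardsD1 i P) iP natrD addrC addKr.
  rewrite mulr_natl -sumr_const le_eqVlt; apply/orP; left; apply/eqP.
  by apply: eq_bigl => j; rewrite !inE andbC.
have := le_trans lo hi; rewrite expr2 -mulrA ler_pM2l //.
set a := moment_sum _ _ _; set p := #|P|%:R; set k := K%:R ^+ l; set w := W%:R ^+ l.
by move=> H; lra.
Qed.

Definition blocks_through {I T : finType} (f : I -> {set T}) (D : {set T}) :=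
  [set i | D \subset f i].

Lemma sum_card_blocks_through (I T : finType) (f : I -> {set T}) (W : nat)
    (D : {set T}) :
  (forall i, #|f i| = W) ->
  (\sum_(s in ~: D) #|blocks_through f (s |: D)| =
     #|blocks_through f D| * (W - #|D|))%N.
Proof.
move=> fW; rewrite -sum_nat_const.
under eq_bigr do rewrite -sum1_card.
rewrite (exchange_big_dep (mem (blocks_through f D))) /=; last first.
  by move=> s i _; rewrite !inE subUset => /andP[].
apply: eq_bigr => i; rewrite inE => Di.
have -> : (W - #|D|)%N = #|f i :\: D| by rewrite cardsD (setIidPr Di) fW.
by rewrite sum1dep_card; apply: eq_card => s; rewrite !inE subUset sub1set Di andbT.
Qed.

Lemma card_blocks_through_le_floor (I T : finType) (f : I -> {set T}) (W : nat)
    (D : {set T}) (m : int) :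
  (forall i, #|f i| = W) -> (#|D| < W)%N ->
  (forall s, s \notin D -> #|blocks_through f (s |: D)|%:Z <= m) ->
  #|blocks_through f D|%:Z <=
    Num.floor ((#|T| - #|D|)%N%:R / (W - #|D|)%N%:R * m%:~R : rat).
Proof.
move=> fW DW hm.
(* The left side is an integer, so bounding it by the argument of the floor suffices. *)
rewrite floor_ge_int mulrAC ler_pdivlMr ?ltr0n ?subn_gt0 //.
have -> : (#|T| - #|D|)%N = #|~: D| by rewrite [RHS]cardsCs setCK.
rewrite (pmulrn _ (W - _)) (pmulrn _ #|~: D|) -!intrM ler_int -PoszM.
rewrite -sum_card_blocks_through // (big_morph _ PoszD (erefl _)).
rewrite -[X in X * m]natz mulr_natl -sumr_const.
by apply: ler_sum => s; rewrite inE; exact: hm.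
Qed.

Lemma card_blocks_through_le_nested_floor (I T : finType) (f : I -> {set T})
    (W d : nat) (m : int) :
  (forall i, #|f i| = W) -> (d <= W)%N ->
  (forall D : {set T}, #|D| = d -> #|blocks_through f D|%:Z <= m) ->
  #|I|%:Z <= nested_floor #|T| W d m.
Proof.
move=> fW dW hm.
(* Induction on the number [k] of floors still to be opened, for all [D] of size [r = d - k]; the
   claim is the case of empty [D]. *)
suff gen k r (D : {set T}) : (r + k = d)%N -> #|D| = r ->
    #|blocks_through f D|%:Z <= foldr (fun r v : _ =>
      Num.floor ((#|T| - r)%N%:R / (W - r)%N%:R * v%:~R : rat)) m (iota r k).
  have := gen d 0%N set0 erefl (cards0 T).
  have -> : blocks_through f set0 = setT by apply/setP=> i; rewrite !inE sub0set.
  by rewrite cardsT.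
elim: k r D => [|k IH] r D; first by rewrite addn0 => -> /hm.
move=> rk Dr; rewrite /= -{1 2}Dr; apply: card_blocks_through_le_floor => //.
  by rewrite Dr (leq_trans _ dW) // -rk -addSnnS leq_addr.
move=> s sD; apply: IH; first by rewrite addSnnS.
by rewrite cardsU1 sD Dr.
Qed.

Lemma johnson_bound (I T : finType) (f : I -> {set T}) (W K : nat) :
  (K < W)%N -> (forall i, #|f i| = W) ->
  (forall i j, i != j -> (#|f i :&: f j| <= K)%N) ->
  #|I|%:Z <= nested_floor #|T| W K
               (Num.floor ((#|T| - K)%N%:R / (W - K)%N%:R : rat)).
Proof.
move=> KW fW fK; apply: card_blocks_through_le_nested_floor => //; first exact: ltnW.
(* A factor 1 makes the innermost floor one more averaging level, with [m = 1]: two distinct blocks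
   cannot share [K.+1] points. *)
move=> D DK; rewrite -[X in Num.floor X]mulr1 -[X in _ * X]/(1%:~R) -DK.
apply: card_blocks_through_le_floor; rewrite ?DK // => s sD.
rewrite lez_nat; apply/card_le1_eqP => i j; rewrite !inE => si sj.
apply/eqP/contraT => /fK; rewrite leqNgt => /negP[].
have -> : K.+1 = #|s |: D| by rewrite cardsU1 sD DK.
by rewrite subset_leq_card // subsetI sj si.
Qed.

(** Removing [D] from the blocks through it leaves sets of size [W - d] in [~: D] that meet pairwise
    in at most [K - d] points, to which [moment_bound] applies. *)
Lemma moment_johnson_bound (I T : finType) (f : I -> {set T}) (W K l d : nat) :
  (K < W)%N -> (forall i, #|f i| = W) ->
  (forall i j, i != j -> (#|f i :&: f j| <= K)%N) ->
  (d <= K)%N ->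
  let A := moment_sum (#|T| - d) (W - d) l in
  0 < A - (K - d)%N%:R ^+ l ->
  #|I|%:Z <= nested_floor #|T| W d
    (Num.floor (((W - d)%N%:R ^+ l - (K - d)%N%:R ^+ l)
                / (A - (K - d)%N%:R ^+ l))).
Proof.
move=> KW fW fK dK A A_gt.
have dW : (d <= W)%N by exact: leq_trans dK (ltnW KW).
apply: card_blocks_through_le_nested_floor => // D Dd.
rewrite floor_ge_int ler_pdivlMr // -pmulrn /A.
have -> : (#|T| - d)%N = #|~: D| by rewrite [RHS]cardsCs setCK Dd.
apply: (@moment_bound _ _ _ (fun i => f i :\: D)); last exact/leq_sub2r/ltnW.
- by move=> i _; rewrite setDE subsetIr.
- by move=> i; rewrite inE => Di; rewrite cardsD (setIidPr Di) fW Dd.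
move=> i j; rewrite !inE => Di Dj ij; rewrite -setDIl cardsD.
have /setIidPr -> : D \subset f i :&: f j by rewrite subsetI Di.
by rewrite Dd leq_sub2r ?fK.
Qed.

Lemma overlapE (S : nat) (x y : binword S) :
  overlap x y = #|[set s | x s] :&: [set s | y s]|.
Proof.
rewrite /overlap -sum1_card [RHS]big_mkcond; apply: eq_bigr => s _.
by rewrite !inE; case: (x s); case: (y s).
Qed.

Theorem lemma2 (R : realType) (X Y : finType) (P : dmc R X Y)
    (S W K N n NID : nat) (lambda1 lambda2 : R)
    (I : id_code P n NID lambda1 lambda2)
    (C : {set binword S}) (c : transmission_code X n S)
    (hKW : (K < W)%N) (hWS : (W <= S)%N)
    (hC : is_cwc N W K C)
    (hI : constructed_by_concatenation I C c) :
  NID%:Z <= nested_floor S W K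
              (Num.floor ((S - K)%N%:R / (W - K)%N%:R : rat))
  /\
  forall l d' : nat, (1 <= l)%N -> (1 <= d' <= K)%N ->
    let S' := (S - d')%N in
    let W' := (W - d')%N in
    let K' := (K - d')%N in
    let A := moment_sum S' W' l in
    0 < A - K'%:R ^+ l ->
    NID%:Z <= nested_floor S W d'
                (Num.floor ((W'%:R ^+ l - K'%:R ^+ l) / (A - K'%:R ^+ l))).
Proof.
have [_ CW CK] := hC; have [x [x_inj xC _]] := hI.
have Cx i : x i \in C by rewrite -xC imset_f.
pose f i := [set s | x i s].
have fW i : #|f i| = W by exact: CW.
have fK i j : i != j -> (#|f i :&: f j| <= K)%N.
  (* Distinct identifiers have distinct codewords, so the overlap bound of the code applies. *)
  by move=> ij; rewrite -overlapE CK // (inj_eq x_inj).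
split=> [|l d' _ /andP[_ dK]].
  by have := @johnson_bound _ _ f W K hKW fW fK; rewrite !card_ord.
by have := @moment_johnson_bound _ _ f W K l d' hKW fW fK dK; rewrite !card_ord.
Qed.
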